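(* Let $X=\{0,1\}^{\mathbb{Z}_+}$ and let $\sigma\colon X\to X$ be the shift map. For every $d\ge 1$ there is a minimal point $x$ in the full shift $(X,\sigma)$ such that the point $(x,x,\dots,x)\in X^{d}$ is recurrent under $\sigma\times\sigma^2\times\dots\times\sigma^{d}$ and the point $(x,x,\dots,x)\in X^{d+1}$ is not recurrent under $\sigma\times\sigma^2\times\dots\times\sigma^{d}\times\sigma^{d+1}$.
   Context: $\mathbb{Z}_+$ is the set of nonnegative integers. $\{0,1\}^{\mathbb{Z}_+}$ carries the product topology (of the discrete topology on $\{0,1\}$), and $\sigma(x)_n=x_{n+1}$ for $n\in\mathbb{Z}_+$. For a compact metric space $(Z,\rho)$ and continuous $R\colon Z\to Z$: a point $z\in Z$ is recurrent under $R$ if $\liminf_{n\to\infty}\rho(R^nz,z)=0$; a subsystem is a nonempty closed $K\subset Z$ with $R(K)\subset K$; it is minimal if it has no proper subsystem; a point is minimal if it belongs to some minimal subsystem of $(Z,R)$. *)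

(* Defs.v *)
From HB Require Import structures.
From mathcomp Require Import all_boot all_order all_algebra.
From mathcomp Require Import all_classical all_reals all_analysis.

Set Implicit Arguments.
Unset Strict Implicit.
Unset Printing Implicit Defensive.

Import Order.TTheory GRing.Theory Num.Theory.

Local Open Scope classical_set_scope.
Local Open Scope ring_scope.

(* The metric is kept separate from the topology so that a statement can
   quantify over all metrics inducing a given (product) topology. *)
Definition compatible_metric (R : realType) (Z : topologicalType)
    (rho : Z -> Z -> R) : Prop :=
  [/\ forall x y, rho x y = 0 <-> x = y,
      forall x y, rho x y = rho y x,
      forall x y z, rho x z <= rho x y + rho y z
    & forall x (A : set Z),
        nbhs x A <-> exists2 e : R, 0 < e & [set y | rho x y < e] `<=` A].

(* The liminf is taken in the extended reals, where it always exists. *)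
Definition recurrent (R : realType) (Z : Type) (rho : Z -> Z -> R)
    (T : Z -> Z) (z : Z) : Prop :=
  limn_einf (fun n => (rho (iter n T z) z)%:E) = 0%E.

Definition subsystem (Z : topologicalType) (T : Z -> Z) (K : set Z) : Prop :=
  [/\ K !=set0, closed K & T @` K `<=` K].

Definition minimal_subsystem (Z : topologicalType) (T : Z -> Z)
    (K : set Z) : Prop :=
  subsystem T K /\ (forall L, subsystem T L -> L `<=` K -> L = K).

Definition minimal_point (Z : topologicalType) (T : Z -> Z) (z : Z) : Prop :=
  exists2 K, minimal_subsystem T K & K z.

Definition cantor_shift (x : cantor_space) : cantor_space := fun n => x n.+1.

Definition cantor_pow (d : nat) : topologicalType :=
  prod_topology (fun _ : 'I_d => cantor_space).

Definition diag (d : nat) (x : cantor_space) : cantor_pow d := fun=> x.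
Arguments diag : clear implicits.

(* Coordinates are numbered from 0, so coordinate i carries the power i + 1. *)
Definition shift_powers (d : nat) (z : cantor_pow d) : cantor_pow d :=
  fun i => iter i.+1 cantor_shift (z i).
Arguments shift_powers : clear implicits.

(* [cantor_pow d] is metrizable, so quantifying over its compatible metrics is
   never vacuous. *)
Section CantorPowMetric.
Variables (R : realType) (d : nat).
Implicit Types (z w : cantor_pow d) (n : nat).

Let differ z w n := [exists i : 'I_d, z i n != w i n].

Let dist z w : R :=
  if pselect (exists n, differ z w n) is left h then (ex_minn h).+1%:R^-1
  else 0.

Let distP z w n : dist z w < n.+1%:R^-1 <->
  forall i m, (m <= n)%N -> z i m = w i m.
Proof.
rewrite /dist; case: pselect => [h|nh].
  case: ex_minnP => k /existsP[i /eqP dk] kmin.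
  rewrite ltf_pV2 ?posrE ?ltr0n// ltr_nat ltnS; split => [nk j m mn|agr].
    apply/eqP/negPn/negP => zw; have /kmin : differ z w m by apply/existsP; exists j.
    by rewrite leqNgt (leq_ltn_trans mn nk).
  by rewrite ltnNge; apply/negP => kn; apply: dk; exact: agr.
rewrite invr_gt0 ltr0n; split => // _ i m _.
by apply/eqP/negPn/negP => zw; apply: nh; exists m; apply/existsP; exists i.
Qed.

Let dist_ge0 z w : 0 <= dist z w.
Proof. by rewrite /dist; case: pselect => // h; rewrite invr_ge0 ler0n. Qed.

Let dist_eq0 z w : dist z w = 0 <-> z = w.
Proof.
split=> [zw|->].
  apply/funext => i; apply/funext => n.
  by have /distP : dist z w < n.+1%:R^-1; [rewrite zw invr_gt0 ltr0n|exact].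
rewrite /dist; case: pselect => // -[n h]; exfalso.
by case/existsP: h => i; rewrite eqxx.
Qed.

Let dist_sym z w : dist z w = dist w z.
Proof.
rewrite /dist; suff -> : differ z w = differ w z by [].
by apply/funext => n; apply: eq_existsb => i; rewrite eq_sym.
Qed.

Let dist_triangle z w v : dist z v <= dist z w + dist w v.
Proof.
rewrite {1}/dist; case: pselect => [h|_]; last exact: addr_ge0.
case: ex_minnP => k /existsP[i /eqP dk] _; rewrite leNgt; apply/negP => lt.
have /distP zw : dist z w < k.+1%:R^-1.
  by apply: le_lt_trans lt; rewrite lerDl.
have /distP wv : dist w v < k.+1%:R^-1.
  by apply: le_lt_trans lt; rewrite lerDr.
by apply: dk; rewrite zw// wv.
Qed.

Let dist_nbhs z (A : set (cantor_pow d)) :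
  nbhs z A <-> exists2 e : R, 0 < e & [set w | dist z w < e] `<=` A.
Proof.
split=> [zA|[e e0 eA]].
  pose F := filter_from setT (fun n => [set w | dist z w < n.+1%:R^-1]).
  have FF : Filter F.
    apply: filter_from_filter; first by exists 0%N.
    move=> m n _ _; exists (maxn m n) => // w /= /distP mn; split; apply/distP.
      by move=> i k km; apply: mn; rewrite leq_max km.
    by move=> i k kn; apply: mn; rewrite leq_max kn orbT.
  have Fz : F --> z.
    apply/cvg_sup => i U [V [[W oW <-] Wzi WU]].
    have zW : nbhs (z i) W by exact: open_nbhs_nbhs.
    suff Fzi : (fun w : cantor_pow d => w i) @ F --> z i.
      by apply: (filterS WU); exact: (Fzi _ zW).
    apply/cvg_sup => n P [Q [[S oS <-] Szn SP]].
    exists n => // w /= /distP zw; apply: SP => /=.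
    by rewrite -zw.
  have [n _ nA] := Fz _ zA; by exists n.+1%:R^-1.
pose n := Num.truncn e^-1.
have ne : n.+1%:R^-1 < e.
  by rewrite invf_plt ?posrE ?ltr0n// truncnS_gt.
pose f (p : 'I_d * 'I_n.+1) := [set w : cantor_pow d | w p.1 p.2 = z p.1 p.2].
have zw : nbhs z [set w | forall p, f p w].
  apply: (@filter_forall _ _ f (nbhs z)) => -[i m].
  have ci : (fun w : cantor_pow d => w i) @ z --> z i.
    exact: (@proj_continuous _ (fun _ : 'I_d => cantor_space) i z).
  have cm : (fun x : cantor_space => x m) @ z i --> z i m.
    exact: (@proj_continuous _ (fun _ : nat => bool) m (z i)).
  exact: (ci _ (cm _ (discrete_set1 (z i m)))).
apply: filterS zw => w /= zw; apply: eA => /=; apply: lt_trans ne.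
by apply/distP => i m mn; have := zw (i, inord m); rewrite /f /= inordK.
Qed.

Lemma cantor_pow_metrizable :
  exists rho : cantor_pow d -> cantor_pow d -> R, compatible_metric rho.
Proof. by exists dist; split. Qed.

End CantorPowMetric.

(* Main.v *)
Require Import Defs.
From mathcomp Require Import all_boot all_order all_algebra.
From mathcomp Require Import all_classical all_reals all_analysis.

(** Fix a prime q > d + 1 and let x_n = 1 exactly when the last nonzero digit of
    n in base q is at most d, with x_0 = 1.

    The sequence x is a Toeplitz-like sequence: x_(m q^k + i) = x_i whenever
    0 < i < q^k, and x_(m q^k) = x_m. Hence the prefix of length q^k reappears at
    position m q^k as soon as x_m = 1 ([digit_seq_prefix]). Taking m = 1 mod q
    shows that prefixes reappear with bounded gaps, which makes x a minimal point
    ([uniformly_recurrent_minimal]). Taking m = 1, ..., d shows that the prefix of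
    length q^k reappears at q^k, 2 q^k, ..., d q^k, so the times q^k witness the
    recurrence of (x, ..., x) under the first d powers of the shift.

    On the other hand x_n, x_(2n), ..., x_((d+1)n) are never all equal to 1 when
    n > 0: the last nonzero digit of j n is j times that of n modulo q, so for
    j = 1, ..., d + 1 these digits are pairwise distinct and nonzero, and they
    cannot all lie in {1, ..., d} ([last_digit_pigeonhole]). As x_0 = 1, the orbit
    of (x, ..., x) under the first d + 1 powers never returns to the clopen set
    of tuples whose d + 1 entries all start with 1. *)

Import Order.TTheory GRing.Theory Num.Theory.

(** * The last nonzero digit in a prime base *)

Section LastDigit.
Variable q : nat.
Hypothesis q_pr : prime q.

(** The part of n prime to q is n stripped of its trailing zeros in base q, so its
    residue modulo q is the last nonzero digit of n. The part of 0 is 1, whence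
    the value 1 at 0. *)
Definition last_digit (n : nat) : nat := n`_(q^') %% q.

Lemma last_digit0 : last_digit 0 = 1.
Proof. by rewrite /last_digit partn0 modn_small ?prime_gt1. Qed.

Lemma last_digit_ndvd n : ~~ (q %| n) -> last_digit n = n %% q.
Proof. by move=> qn; rewrite /last_digit part_pnat_id ?p'natE. Qed.

Lemma last_digitMq n : last_digit (n * q) = last_digit n.
Proof.
have [->|n_gt0] := posnP n; first by rewrite mul0n.
have q_part : q`_(q^') = 1 by apply: part_p'nat; rewrite pnatNK pnat_id.
by rewrite /last_digit partnM ?(prime_gt0 q_pr)// q_part muln1.
Qed.

Lemma last_digitMqX n k : last_digit (n * q ^ k) = last_digit n.
Proof. by elim: k => [|k IHk]; rewrite ?muln1// expnSr mulnA last_digitMq. Qed.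

(** A nonzero digit among the k lowest ones is not affected by the higher ones. *)
Lemma last_digit_periodic k m n : ~~ (q ^ k %| n) ->
  last_digit (m * q ^ k + n) = last_digit n.
Proof.
elim: k n => [|k IHk] n; first by rewrite dvd1n.
have [/dvdnP[n' ->]|qn _] := boolP (q %| n).
  rewrite expnSr dvdn_pmul2r ?prime_gt0// mulnA -mulnDl !last_digitMq.
  exact: IHk.
have qM : q %| m * q ^ k.+1 by rewrite expnSr mulnA dvdn_mull.
rewrite !last_digit_ndvd ?dvdn_addr//.
by rewrite -modnDml (eqP qM) add0n.
Qed.

Lemma last_digit_gt0 n : 0 < last_digit n.
Proof.
by rewrite /last_digit lt0n -[_ == 0]/(q %| _) -p'natE ?part_pnat.
Qed.

Lemma last_digitM j n : 0 < j < q -> 0 < n ->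
  last_digit (j * n) = (j * last_digit n) %% q.
Proof.
move=> /andP[j_gt0 jq] n_gt0.
rewrite /last_digit partnM// modnMmr part_pnat_id// p'natE//.
by rewrite gtnNdvd.
Qed.

Lemma last_digitM_inj i j n : 0 < n -> 0 < i < q -> 0 < j < q ->
  last_digit (i * n) = last_digit (j * n) -> i = j.
Proof.
move=> n_gt0; wlog ij : i j / i <= j.
  by move=> wl iq jq; case: (leqP i j) => [/wl|/ltnW/wl h /esym/h->]; auto.
move=> iq jq; rewrite !last_digitM// => /esym/eqP.
rewrite eqn_mod_dvd ?leq_mul2r ?ij ?orbT// -mulnBl Euclid_dvdM//.
have ndvd k : 0 < k < q -> ~~ (q %| k) by case/andP=> k0 kq; rewrite gtnNdvd.
rewrite (negPf (ndvd (last_digit n) _)) ?last_digit_gt0 ?ltn_pmod ?prime_gt0//.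
case/andP: jq => _ jq.
rewrite orbF /dvdn modn_small ?(leq_ltn_trans (leq_subr _ _) jq)// subn_eq0.
by move=> ji; apply/eqP; rewrite eqn_leq ij.
Qed.

(** The last nonzero digits of n, 2n, ..., (d+1)n are d + 1 distinct positive
    numbers, too many to be all at most d. *)
Lemma last_digit_pigeonhole d n : d.+1 < q -> 0 < n ->
  exists2 i, i <= d & d < last_digit (i.+1 * n).
Proof.
move=> dq n_gt0; apply: contrapT => small.
pose s := [seq last_digit (i * n) | i <- iota 1 d.+1].
have s_uniq : uniq s.
  rewrite map_inj_in_uniq ?iota_uniq// => i j.
  rewrite !mem_iota !add1n => /andP[i0 id] /andP[j0 jd].
  by apply: last_digitM_inj; rewrite // ?i0 ?j0 ?(leq_trans id) ?(leq_trans jd).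
have : {subset s <= iota 1 d}.
  move=> _ /mapP[[|i] /[!mem_iota]// /andP[_ id] ->].
  rewrite last_digit_gt0 add1n ltnS leqNgt/=.
  by apply/negP => lt_d; apply: small; exists i.
by move=> /(uniq_leq_size s_uniq); rewrite size_map !size_iota ltnn.
Qed.

Definition digit_seq (d : nat) : cantor_space := fun n => last_digit n <= d.

(** At i = 0 both values are true, on the left because of the hypothesis on m;
    the other positions lie strictly between multiples of q ^ k, where the values
    are periodic. *)
Lemma digit_seq_prefix d k m i : 0 < d -> last_digit m <= d -> i < q ^ k ->
  digit_seq d (m * q ^ k + i) = digit_seq d i.
Proof.
rewrite /digit_seq => d_gt0 md; have [->|i_gt0] := posnP i.
  by rewrite addn0 last_digitMqX last_digit0 md d_gt0.
by move=> ik; rewrite last_digit_periodic// gtnNdvd.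
Qed.

End LastDigit.

Local Open Scope classical_set_scope.

(** * Uniformly recurrent sequences are minimal points *)

Lemma iter_cantor_shift n (x : cantor_space) m :
  iter n cantor_shift x m = x (n + m).
Proof. by elim: n m => // n IHn m; rewrite iterS /cantor_shift IHn addnS. Qed.

Lemma iter_shift_powers d n (z : cantor_pow d) i :
  iter n (shift_powers d) z i = iter (n * i.+1) cantor_shift (z i).
Proof.
by elim: n => // n IHn; rewrite iterS {1}/shift_powers IHn -iterD -mulSn.
Qed.

Lemma cvg_prod_topology (I : Type) (T : I -> topologicalType)
    (F : set_system (prod_topology T)) (z : prod_topology T) : Filter F ->
  (forall i, w i @[w --> F] --> z i) -> F --> z.
Proof.
move=> FF Fz; apply/cvg_sup => i U [V [[W oW <-] Wz] VU].
by apply: (filterS VU); apply: (Fz i); exact: open_nbhs_nbhs.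
Qed.

Lemma cvg_cantor (u : nat -> cantor_space) (x : cantor_space) :
  (forall k i, i < k -> u k i = x i) -> u @ \oo --> x.
Proof.
move=> ux; apply: cvg_prod_topology => i A /nbhs_singleton Axi.
by exists i.+1 => // k /= ik; rewrite /= ux.
Qed.

Lemma near_prefix (x : cantor_space) N :
  \forall y \near x, forall i, i < N -> y i = x i.
Proof.
have : nbhs x [set y : cantor_space | forall i : 'I_N, y i = x i].
  apply: (@filter_forall _ _ (fun i y => y (val i) = x (val i)) (nbhs x)) => i.
  apply: (@proj_continuous _ (fun _ : nat => bool) i x [set x i]).
  exact: discrete_set1.
by apply: filterS => y yx i iN; exact: (yx (Ordinal iN)).
Qed.

Lemma closed_prefix (L : set cantor_space) (x : cantor_space) : closed L ->
  (forall N, exists2 y, L y & forall i, i < N -> y i = x i) -> L x.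
Proof.
move=> cL Lx; have {Lx} /choice[u uP] : forall N, exists y,
    L y /\ forall i, i < N -> y i = x i.
  by move=> N; have [y] := Lx N; exists y.
apply: (closed_cvg (u_ := u) (F := \oo) L) => //.
  by apply: nearW => n; case: (uP n).
by apply: cvg_cantor => k; case: (uP k).
Qed.

Definition uniformly_recurrent (x : cantor_space) : Prop :=
  forall N, exists B, forall n, exists2 t, t <= B &
    forall i, i < N -> x (n + t + i) = x i.

(** Any subsystem L of the orbit closure of x contains some y; long prefixes of y
    are words of x, so by bounded gaps they contain each prefix of x. Thus L
    contains shifts of y arbitrarily close to x, hence x and its orbit closure. *)
Lemma uniformly_recurrent_minimal x :
  uniformly_recurrent x -> minimal_point cantor_shift x.
Proof.
move=> urx.
(* K is the orbit closure of x *)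
pose K : set cantor_space :=
  [set y | forall N, exists n, forall i, i < N -> y i = x (n + i)].
have Kx : K x by move=> N; exists 0.
exists K => //; split.
  split; [by exists x| |].
    move=> y Ky N; have [z [Kz zy]] := Ky _ (near_prefix y N).
    by have [n nz] := Kz N; exists n => i iN; rewrite -zy// nz.
  move=> _ [y Ky <-] N; have [n ny] := Ky N.+1.
  by exists n.+1 => i iN; rewrite /cantor_shift ny// addnS.
move=> L [[y Ly] cL sL] LK.
have iterL n z : L z -> L (iter n cantor_shift z).
  by move=> Lz; elim: n => // n IHn; apply: sL; exists (iter n cantor_shift z).
have Lx : L x.
  apply: closed_prefix => // N; have [B urB] := urx N.
  have [n ny] := LK _ Ly (B + N); have [t tB tx] := urB n.
  exists (iter t cantor_shift y); first exact: iterL.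
  move=> i iN; rewrite iter_cantor_shift ny ?addnA ?tx//.
  by rewrite -addnS leq_add.
apply/seteqP; split=> // z Kz; apply: closed_prefix => // N.
have [n nz] := Kz N; exists (iter n cantor_shift x); first exact: iterL.
by move=> i iN; rewrite iter_cantor_shift nz.
Qed.

(** The prefix of length q ^ N reappears at every position m * q ^ N where the
    last nonzero digit of m is at most d. All m congruent to 1 modulo q qualify,
    so these positions contain a full residue class modulo q ^ N.+1. *)
Lemma digit_seq_uniformly_recurrent q d : prime q -> 0 < d ->
  uniformly_recurrent (digit_seq q d).
Proof.
move=> q_pr d_gt0 N; have q_gt1 := prime_gt1 q_pr; exists (2 * q ^ N.+1) => n.
have qN : 0 < q ^ N.+1 by rewrite expn_gt0 ltnW.
pose m := (n %/ q ^ N.+1).+1.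
have m_ge : n <= m * q ^ N.+1 by apply/ltnW; rewrite ltn_ceil.
(* n + t is the first position (m * q + 1) * q ^ N with m * q ^ N.+1 > n *)
exists (q ^ N + (m * q ^ N.+1 - n)).
  rewrite mul2n -addnn leq_add ?leq_exp2l// leq_subLR mulSn addnC leq_add2r.
  exact: leq_trunc_div.
move=> i iN.
have -> : n + (q ^ N + (m * q ^ N.+1 - n)) + i = (m * q + 1) * q ^ N + i.
  by rewrite addnCA subnKC// mulnDl mul1n -mulnA -expnS [q ^ N + _]addnC.
apply: digit_seq_prefix => //; last exact: ltn_trans iN (ltn_expl _ _).
rewrite last_digit_ndvd ?dvdn_addr ?dvdn_mull// ?gtnNdvd//.
by rewrite modnMDl modn_small.
Qed.

(** * Recurrence with respect to an arbitrary compatible metric *)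

Lemma compatible_metric_ge0 (R : realType) (Z : topologicalType)
    (rho : Z -> Z -> R) x y : compatible_metric rho -> (0 <= rho x y)%R.
Proof.
move=> [rho0 rhoC rhoT _]; have := rhoT x y x.
by rewrite (rhoC y x) (proj2 (rho0 x x) erefl) -mulr2n pmulrn_lge0.
Qed.

(** The tail infima of the distances are all 0, since the times n_ k reach
    arbitrarily far. *)
Lemma recurrent_cvg (R : realType) (Z : topologicalType) (rho : Z -> Z -> R)
    (T : Z -> Z) (z : Z) (n_ : nat -> nat) : compatible_metric rho ->
  (forall k, k <= n_ k) -> iter (n_ k) T z @[k --> \oo] --> z ->
  recurrent rho T z.
Proof.
move=> crho n_ge cvgz; rewrite /recurrent limn_einf_lim.
suff -> : einfs (fun n => (rho (iter n T z) z)%:E) = cst 0%E by exact: lim_cst.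
apply/funext => n; apply/eqP; rewrite eq_le; apply/andP; split; last first.
  apply: le_ereal_inf_tmp => _ [k _ <-].
  by rewrite lee_fin compatible_metric_ge0.
apply/lee_addgt0Pr => e e_gt0; rewrite add0e.
case: (crho) => _ rhoC _ /(_ z [set y | rho z y < e]%R) [_ nbhsz].
have /cvgz [k _ kP] : nbhs z [set y | rho z y < e]%R by apply: nbhsz; exists e.
apply: (@le_trans _ _ (rho (iter (n_ (maxn k n)) T z) z)%:E).
  apply: ereal_inf_lbound; exists (n_ (maxn k n)) => //=.
  exact: leq_trans (leq_maxr _ _) (n_ge _).
rewrite lee_fin rhoC; apply: ltW.
by apply: (kP (maxn k n)); exact: leq_maxl.
Qed.

Lemma not_recurrent_nbhs (R : realType) (Z : topologicalType)
    (rho : Z -> Z -> R) (T : Z -> Z) (z : Z) (A : set Z) :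
  compatible_metric rho -> nbhs z A -> (forall n, 0 < n -> ~ A (iter n T z)) ->
  ~ recurrent rho T z.
Proof.
move=> [_ rhoC _ rhoN] /rhoN[e e_gt0 eA] nA.
rewrite /recurrent limn_einf_lim => lim0.
suff : (e%:E <= 0 :> \bar R)%E by rewrite lee_fin leNgt e_gt0.
rewrite -lim0; apply: lime_ge; first exact: is_cvg_einfs.
exists 1 => // n /= n_gt0; apply: le_ereal_inf_tmp => _ [k /= nk <-].
rewrite lee_fin leNgt; apply/negP => ke; apply: (nA k (leq_trans n_gt0 nk)).
by apply: eA; rewrite /= rhoC.
Qed.

(** * Separating d-fold from (d+1)-fold recurrence *)

Theorem theorem3p9 (R : realType) (d : nat) (d_ge1 : (1 <= d)%N) :
  exists x : cantor_space,
    [/\ minimal_point cantor_shift x,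
        forall rho : cantor_pow d -> cantor_pow d -> R,
          compatible_metric rho -> recurrent rho (shift_powers d) (diag d x)
      & forall rho : cantor_pow d.+1 -> cantor_pow d.+1 -> R,
          compatible_metric rho ->
          ~ recurrent rho (shift_powers d.+1) (diag d.+1 x)].
Proof.
have [q dq q_pr] := prime_above d.+1; have q_gt1 := prime_gt1 q_pr.
exists (digit_seq q d); split.
- exact/uniformly_recurrent_minimal/digit_seq_uniformly_recurrent.
- move=> rho crho; apply: (@recurrent_cvg _ _ _ _ _ (expn q)) => //.
    by move=> k; apply/ltnW/ltn_expl.
  apply: cvg_prod_topology => i; apply: cvg_cantor => k m mk.
  rewrite iter_shift_powers iter_cantor_shift mulnC.
  apply: digit_seq_prefix => //; last exact: ltn_trans mk (ltn_expl _ _).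
  have iq : i.+1 < q by apply: leq_ltn_trans dq; rewrite ltnS ltnW.
  by rewrite last_digit_ndvd ?gtnNdvd// modn_small.
- move=> rho crho.
  pose A : set (cantor_pow d.+1) := [set z | forall i, z i 0 = true].
  apply: (@not_recurrent_nbhs _ _ _ _ _ A) => //.
    apply: (@filter_forall _ _ (fun i (z : cantor_pow d.+1) => z i 0 = true)
      (nbhs (diag d.+1 (digit_seq q d)))) => i.
    apply: (@proj_continuous _ (fun _ : 'I_d.+1 => cantor_space) i _
      [set y | y 0 = true]).
    apply: filterS (near_prefix _ 1) => y yx; rewrite /= yx// /diag.
    by rewrite /proj /digit_seq last_digit0.
  move=> n n_gt0 An; have [i id] := last_digit_pigeonhole _ q_pr _ _ dq n_gt0.
  have := An (Ordinal (id : i < d.+1)).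
  rewrite iter_shift_powers iter_cantor_shift addn0 mulnC /digit_seq /diag/=.
  by rewrite ltnNge => ->.
Qed.
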